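(* Let $R$ be a ring and let $G$ be a finite group acting on $R$. Then the skew group ring $RG$ is a Ding-Chen ring if and only if $R$ is a Ding-Chen ring.
   Context: Rings are associative with identity; modules are unitary. $G$ acts on $R$ by ring automorphisms: $r\mapsto g(r)$ is a ring automorphism for each $g\in G$, $(g_1g_2)(r)=g_1(g_2(r))$ and $1(r)=r$. The skew group ring $RG$ is the free left $R$-module with basis $G$ and multiplication $(ag)(bh)=a\,g(b)\,gh$ for $a,b\in R$, $g,h\in G$. For a ring $A$ and a (left or right) $A$-module $M$, the $(1,0)$-injective dimension of $M$ is the smallest integer $k\ge 0$ such that $\operatorname{Ext}^{k+1}_A(F,M)=0$ for every finitely presented $A$-module $F$ (on the same side as $M$), and $\infty$ if no such $k$ exists. A ring $A$ is an $n$-FC ring if it is both left and right coherent and the $(1,0)$-injective dimensions of $A$ as a right and as a left module over itself are both equal to $n$. A ring is a Ding-Chen ring if it is an $n$-FC ring for some integer $n\ge 0$. *)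

(* Defs.v *)
From HB Require Import structures.
From mathcomp Require Import all_boot all_order all_algebra all_fingroup.

Set Implicit Arguments.
Unset Strict Implicit.
Unset Printing Implicit Defensive.

Import GRing.Theory.
Local Open Scope ring_scope.

(* Rings are pzRingType, so the zero ring is allowed.                         *)
(* Bijectivity of each r |-> alpha g r follows from the last two fields.      *)
Record ring_action (G : finGroupType) (R : pzRingType) := RingAction {
  ract :> G -> {rmorphism R -> R};
  ract1 : forall r, ract 1%g r = r;
  ractM : forall g h r, ract (g * h)%g r = ract g (ract h r) }.

(* The function f : G -> R stands for the formal sum of the (f g) g. This     *)
(* alias hides the pointwise product that {ffun G -> R} carries by default.   *)
Definition skew_group_ring (G : finGroupType) (R : pzRingType)
  (alpha : ring_action G R) : Type := {ffun G -> R}.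

Section SkewGroupRing.
Variables (G : finGroupType) (R : pzRingType) (alpha : ring_action G R).
Local Notation RG := (skew_group_ring alpha).

HB.instance Definition _ := GRing.Zmodule.copy RG {ffun G -> R}.

Definition skew_mono (a : R) (g : G) : RG :=
  [ffun x => if x == g then a else 0].

Definition skew_one : RG := skew_mono 1 1%g.

(* (a g)(b h) = a g(b) gh: the coefficient at x collects the pairs            *)
(* (g, h) with h = g^-1 x.                                                    *)
Definition skew_mul (u v : RG) : RG :=
  [ffun x => \sum_(g : G) u g * alpha g (v (g^-1 * x)%g)].

Fact skew_mulA : associative skew_mul.
Proof.
move=> u v w; apply/ffunP=> x; rewrite !ffunE.
under eq_bigr => g _ do rewrite ffunE raddf_sum mulr_sumr.
under [RHS]eq_bigr => g _ do rewrite ffunE mulr_suml.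
rewrite [RHS]exchange_big /=; apply: eq_bigr => g _.
rewrite [RHS](reindex_inj (mulgI g)) /=; apply: eq_bigr => h _.
by rewrite mulKg rmorphM /= ractM invMg mulgA mulrA.
Qed.

Fact skew_mul1 : left_id skew_one skew_mul.
Proof.
move=> u; apply/ffunP=> x; rewrite !ffunE (bigD1 1%g) //= ffunE eqxx.
rewrite mul1r ract1 invg1 mul1g big1 ?addr0 // => g /negPf gN1.
by rewrite ffunE gN1 mul0r.
Qed.

Fact skew_mulr1 : right_id skew_one skew_mul.
Proof.
move=> u; apply/ffunP=> x; rewrite !ffunE (bigD1 x) //= ffunE mulVg eqxx.
rewrite rmorph1 mulr1 big1 ?addr0 // => g gNx; rewrite ffunE.
by rewrite -eq_mulVg1 (negPf gNx) rmorph0 mulr0.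
Qed.

Fact skew_mulDl : left_distributive skew_mul +%R.
Proof.
move=> u v w; apply/ffunP=> x; rewrite !ffunE -big_split /=.
by apply: eq_bigr => g _; rewrite ffunE mulrDl.
Qed.

Fact skew_mulDr : right_distributive skew_mul +%R.
Proof.
move=> u v w; apply/ffunP=> x; rewrite !ffunE -big_split /=.
by apply: eq_bigr => g _; rewrite ffunE rmorphD mulrDr.
Qed.

HB.instance Definition _ := GRing.Zmodule_isPzRing.Build RG
  skew_mulA skew_mul1 skew_mulr1 skew_mulDl skew_mulDr.

Lemma skew_monoM (a b : R) (g h : G) :
  skew_mono a g * skew_mono b h = skew_mono (a * alpha g b) (g * h)%g.
Proof.
apply/ffunP=> x; rewrite !ffunE (bigD1 g) //= !ffunE eqxx.
rewrite big1 ?addr0 => [|k /negPf kNg]; last by rewrite ffunE kNg mul0r.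
by rewrite (can2_eq (mulKVg g) (mulKg g)); case: eqP => _ //; rewrite rmorph0 mulr0.
Qed.

Lemma skew_mono_sum (u : RG) : u = \sum_(g : G) skew_mono (u g) g.
Proof.
apply/ffunP=> x; rewrite sum_ffunE (bigD1 x) //= ffunE eqxx.
by rewrite big1 ?addr0 // => g gNx; rewrite ffunE eq_sym (negPf gNx).
Qed.

End SkewGroupRing.

(* All modules below are left modules; right modules over A are left modules  *)
(* over the converse ring A^c.                                                *)

Definition finitely_generated (A : pzRingType) (M : lmodType A) : Prop :=
  exists (n : nat) (p : {linear 'rV[A]_n -> M}), forall x, exists y, p y = x.

Definition finitely_presented (A : pzRingType) (M : lmodType A) : Prop :=
  exists (m n : nat) (q : {linear 'rV[A]_m -> 'rV[A]_n})
    (p : {linear 'rV[A]_n -> M}),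
    (forall x, exists y, p y = x) /\
    (forall y, p y = 0 <-> exists z, q z = y).

(* A left ideal is given as a module I with an injective linear map into A.   *)
Definition left_coherent (A : pzRingType) : Prop :=
  forall (I : lmodType A) (i : {linear I -> A^o}), injective i ->
    finitely_generated I -> finitely_presented I.

Definition right_coherent (A : pzRingType) : Prop := left_coherent A^c.

Definition projective (A : pzRingType) (P : lmodType A) : Prop :=
  forall (B C : lmodType A) (p : {linear B -> C}) (f : {linear P -> C}),
    (forall c, exists b, p b = c) ->
    exists h : {linear P -> B}, forall x, p (h x) = f x.

Record proj_resolution (A : pzRingType) (F : lmodType A) := ProjResolution {
  res_obj :> nat -> lmodType A;
  res_diff : forall n, {linear res_obj n.+1 -> res_obj n};
  res_aug : {linear res_obj 0 -> F};
  res_proj : forall n, projective (res_obj n);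
  res_aug_surj : forall x, exists y, res_aug y = x;
  res_exact0 : forall y, res_aug y = 0 <-> exists z, res_diff 0 z = y;
  res_exactS : forall n y,
    res_diff n y = 0 <-> exists z, res_diff n.+1 z = y }.

Section Ext.
Variables (A : pzRingType) (F M : lmodType A) (P : proj_resolution F).

Definition Ext_cocycle n (f : {linear P n -> M}) : Prop :=
  forall x, f (res_diff P n x) = 0.

Definition Ext_coboundary n : {linear P n -> M} -> Prop :=
  match n with
  | 0 => fun f => forall x, f x = 0
  | k.+1 => fun f =>
      exists g : {linear P k -> M}, forall x, f x = g (res_diff P k x)
  end.

End Ext.

(* Ext^n_A(F, M) = 0, where Ext^n_A(F, M) is the n-th cohomology of           *)
(* Hom_A(P, M). It does not depend on the projective resolution P of F up to  *)
(* isomorphism, and every F has one, so quantifying over all P is harmless.   *)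
Definition Ext_vanishes (A : pzRingType) (n : nat) (F M : lmodType A) : Prop :=
  forall (P : proj_resolution F) (f : {linear P n -> M}),
    Ext_cocycle f -> Ext_coboundary f.

Definition fp_Ext_vanishes (A : pzRingType) (k : nat) (M : lmodType A) : Prop :=
  forall F : lmodType A, finitely_presented F -> Ext_vanishes k.+1 F M.

(* The (1,0)-injective dimension of M is the integer k; it is infinite when   *)
(* this holds for no k.                                                       *)
Definition inj10_dim (A : pzRingType) (M : lmodType A) (k : nat) : Prop :=
  fp_Ext_vanishes k M /\
  forall j : nat, fp_Ext_vanishes j M -> (k <= j)%N.

Definition n_FC_ring (n : nat) (A : pzRingType) : Prop :=
  [/\ left_coherent A, right_coherent A,
      @inj10_dim A^c (A^c)^o n & @inj10_dim A A^o n].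

Definition Ding_Chen_ring (A : pzRingType) : Prop :=
  exists n : nat, n_FC_ring n A.

(* Main.v *)
Require Import Defs.
From HB Require Import structures.
From mathcomp Require Import all_boot all_order all_algebra all_fingroup.
From mathcomp Require Import boolp.

Set Implicit Arguments.
Unset Strict Implicit.
Unset Printing Implicit Defensive.

Import GRing.Theory.
Local Open Scope ring_scope.

(* A skew group ring S over R is free of rank #|G| on both sides, and induction
   of modules from R to S is both left and right adjoint to restriction. Hence
   both functors are exact and preserve projectives and finite presentation,
   which transfers coherence (M is a direct summand of the restriction of the
   module it induces), and Shapiro's lemma for the two adjunctions shows that
   Ext^k(F, ind M) vanishes for all finitely presented S-modules F iff
   Ext^k(F, M) does for all finitely presented R-modules F. As ind R = S, the
   (1,0)-injective dimensions agree. Right modules are covered because the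
   converse of RG is a skew group ring over the converse of R. *)

Definition make_linear (A : pzRingType) (U V : lmodType A) (f : U -> V)
    (f_lin : linear f) : {linear U -> V} :=
  HB.pack f (GRing.isLinear.Build A U V _ f f_lin).

(** * Finitely presented modules and coherence *)

Section FinitePresentation.
Variable A : pzRingType.
Implicit Types M N Q F : lmodType A.

Definition surjective_map T U (f : T -> U) := forall x, exists y, f y = x.

Definition exact_at M N F (q : M -> N) (p : N -> F) :=
  forall y, p y = 0 <-> exists z, q z = y.

Definition row_comb M n (v : 'I_n -> M) (u : 'rV[A]_n) : M :=
  \sum_i u 0 i *: v i.

Lemma row_comb_linear M n (v : 'I_n -> M) : linear (row_comb v).
Proof.
move=> a x y; rewrite /row_comb scaler_sumr -big_split /=.
by apply: eq_bigr => i _; rewrite !mxE scalerDl scalerA.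
Qed.

Definition row_map M n (v : 'I_n -> M) : {linear 'rV[A]_n -> M} :=
  make_linear (row_comb_linear v).

Lemma row_map_delta M n (f : {linear 'rV[A]_n -> M}) :
  f =1 row_map (fun i => f (delta_mx 0 i)).
Proof.
move=> u; rewrite {1}[u]row_sum_delta linear_sum.
by apply: eq_bigr => i _; rewrite linearZ.
Qed.

Lemma eq_row_map M n (v w : 'I_n -> M) : v =1 w -> row_map v =1 row_map w.
Proof. by move=> vw u; apply: eq_bigr => i _; rewrite vw. Qed.

Lemma linear_row_map M N n (f : {linear M -> N}) (v : 'I_n -> M) u :
  f (row_map v u) = row_map (fun i => f (v i)) u.
Proof.
by rewrite /= /row_comb linear_sum; apply: eq_bigr => i _; rewrite linearZ.
Qed.

Lemma row_lift M N n (p : {linear M -> N}) (v : 'I_n -> N) :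
  (forall i, exists y, p y = v i) ->
  exists h : {linear 'rV[A]_n -> M}, forall u, p (h u) = row_map v u.
Proof.
move=> /choice[w wE]; exists (row_map w) => u.
by rewrite linear_row_map; apply: eq_row_map.
Qed.

Lemma row_projective M N n (p : {linear M -> N}) (f : {linear 'rV[A]_n -> N}) :
  surjective_map p -> exists h : {linear 'rV[A]_n -> M}, forall u, p (h u) = f u.
Proof.
move=> p_surj.
have [h hE] := row_lift (v := fun i => f (delta_mx 0 i)) (fun i => p_surj _).
by exists h => u; rewrite hE -row_map_delta.
Qed.

Definition pair_map M N F (f : {linear M -> F}) (g : {linear N -> F})
   : {linear (M * N)%type -> F}.
Proof.
apply: (@make_linear _ _ _ (fun x => f x.1 + g x.2)) => a [x1 x2] [y1 y2] /=.
by rewrite !linearP scalerDr addrACA.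
Defined.

Lemma fg_surj M N (p : {linear M -> N}) :
  surjective_map p -> finitely_generated M -> finitely_generated N.
Proof.
move=> p_surj [n [q q_surj]]; exists n, (p \o q) => x.
have [y <-] := p_surj x; have [z <-] := q_surj y.
by exists z.
Qed.

Lemma fp_fg M : finitely_presented M -> finitely_generated M.
Proof. by move=> [m [n [q [p [p_surj _]]]]]; exists n, p. Qed.

Lemma fg_row n : finitely_generated 'rV[A]_n.
Proof. by exists n, (make_linear (f := id) (fun _ _ _ => erefl)) => x; exists x. Qed.

Lemma fg_pair M N :
  finitely_generated M -> finitely_generated N -> finitely_generated (M * N)%type.
Proof.
move=> [m [p p_surj]] [n [q q_surj]].
have lin : linear (fun u : 'rV[A]_(m + n) => (p (lsubmx u), q (rsubmx u))).
  by move=> a x y; rewrite !linearP.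
exists (m + n)%N, (make_linear lin) => -[x y].
have [[x' <-] [y' <-]] := (p_surj x, q_surj y).
by exists (row_mx x' y'); rewrite /= row_mxKl row_mxKr.
Qed.

(* A finitely presented Q modulo a finitely generated submodule stays finitely
   presented: lift the extra relations to the free module covering Q. *)
Lemma fp_quotient N Q F (r : {linear N -> Q}) (p : {linear Q -> F}) :
  finitely_generated N -> finitely_presented Q ->
  surjective_map p -> exact_at r p -> finitely_presented F.
Proof.
move=> [k [s s_surj]] [m [n [q [pi [pi_surj pi_ker]]]]] p_surj p_ker.
have [t tE] := row_projective (r \o s) pi_surj.
have [l [e e_surj]] := fg_pair (fg_row m) (fg_row k).
exists l, n, (pair_map q t \o e), (p \o pi); split.
  move=> x; have [y <-] := p_surj x; have [z <-] := pi_surj y.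
  by exists z.
move=> y; split=> [/= /p_ker[z rz]|[z <-]] /=.
  have [z' sz] := s_surj z.
  have /pi_ker[x qx] : pi (y - t z') = 0.
    by rewrite linearB tE /= sz rz subrr.
  have [w ew] := e_surj (x, z').
  by exists w; rewrite ew /= qx subrK.
rewrite /= linearD tE /=.
have -> : pi (q (e z).1) = 0 by apply/pi_ker; exists (e z).1.
by rewrite add0r; apply/p_ker; exists (s (e z).2).
Qed.

(** Two covers of [M] are compared, as in Schanuel's lemma, by lifting each through the other. If
    [p (s x) = 0], then [s x] is the sum of [h (t x)], the lift of a relation of [M], and the
    correction [s x - h (t x)]; elements of these two kinds generate the kernel. *)
Lemma fp_kernel_fg Q M (p : {linear Q -> M}) :
  finitely_generated Q -> finitely_presented M -> surjective_map p ->
  exists m (r : {linear 'rV[A]_m -> Q}), exact_at r p.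
Proof.
move=> [k [s s_surj]] [m [n [q [pi [pi_surj pi_ker]]]]] p_surj.
have [h hE] := row_projective pi p_surj.
have [t tE] := row_projective (p \o s) pi_surj.
have [l [e e_surj]] := fg_pair (fg_row m) (fg_row k).
have lin : linear (fun y => s y - h (t y)).
  by move=> a x y; rewrite !linearP /= scalerBr -scalerN addrACA.
exists l, (pair_map (h \o q) (make_linear lin) \o e) => y; split=> [py|[z <-]].
  have [x sx] := s_surj y.
  have /pi_ker[z qz] : pi (t x) = 0 by rewrite tE /= sx.
  have [w ew] := e_surj (z, x).
  by exists w; rewrite /= ew /= qz sx addrC subrK.
rewrite /= linearD linearB !hE tE /= subrr addr0.
by apply/pi_ker; exists (e z).1.
Qed.

(** The kernel of [p] is the image of [x - i (p x)], hence finitely generated because [M] is. *)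
Lemma fp_retract M N (i : {linear N -> M}) (p : {linear M -> N}) :
  cancel i p -> finitely_presented M -> finitely_presented N.
Proof.
move=> iK M_fp.
have lin : linear (fun x => x - i (p x)).
  by move=> a x y; rewrite !linearP /= scalerBr -scalerN addrACA.
apply: (fp_quotient (r := make_linear lin) (p := p) (fp_fg M_fp) M_fp).
  by move=> x; exists (i x).
move=> y; split=> [py|[z <-]] /=; last by rewrite linearB iK subrr.
by exists y; rewrite /= py linear0 subr0.
Qed.

(** A finite basis gives a presentation without relations, hence the rank [0%N]. Any finite type may
    index the basis, so that pairs can be used later. *)
Lemma fp_basis (T : finType) M (b : T -> M) (c : M -> T -> A) :
  (forall x, x = \sum_t c x t *: b t) ->
  (forall a : T -> A, \sum_t a t *: b t = 0 -> forall t, a t = 0) ->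
  finitely_presented M.
Proof.
move=> cE b_free; exists 0%N, #|T|.
have mapE (v : 'rV[A]_#|T|) : row_map (fun i => b (enum_val i)) v
    = \sum_t v 0 (enum_rank t) *: b t.
  rewrite /= /row_comb [RHS](reindex (@enum_val T predT)) /=; last first.
    exact/onW_bij/enum_val_bij.
  by apply: eq_bigr => i _; rewrite enum_valK.
exists (row_map (fun=> 0)), (row_map (fun i => b (enum_val i))); split.
  move=> x; exists (\row_i c x (enum_val i)); rewrite mapE [RHS]cE.
  by apply: eq_bigr => t _; rewrite mxE enum_rankK.
move=> y; rewrite mapE; split=> [/b_free y0|[z <-]].
  exists 0; rewrite linear0; apply/rowP => i.
  by rewrite mxE -(enum_valK i) y0.
by rewrite big1 // => t _; rewrite /= /row_comb big_ord0 mxE scale0r.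
Qed.

End FinitePresentation.

Section Image.
Variables (A : pzRingType) (M N : lmodType A) (f : {linear M -> N}).

(** Coherence speaks of ideals as modules with an injection, so the image is made a module in its
    own right, as a subtype cut out by classical membership. *)
Definition image_pred : {pred N} := fun y => `[< exists x, f x = y >].

Fact image_submod_closed : submod_closed image_pred.
Proof.
split=> [|a u v /asboolP[x <-] /asboolP[y <-]]; apply/asboolP.
  by exists 0; rewrite linear0.
by exists (a *: x + y); rewrite linearP.
Qed.

HB.instance Definition _ :=
  GRing.isSubmodClosed.Build A N image_pred
    (GRing.submod_closed_semi image_submod_closed).

Record image_module := ImageModule {image_val :> N; _ : image_val \in image_pred}.
HB.instance Definition _ := [isSub for image_val].
HB.instance Definition _ := [Choice of image_module by <:].
HB.instance Definition _ := [SubChoice_isSubZmodule of image_module by <:].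
HB.instance Definition _ := [SubZmodule_isSubLmodule of image_module by <:].

Lemma image_factorization :
  exists (I : lmodType A) (i : {linear I -> N}) (p : {linear M -> I}),
    [/\ injective i, surjective_map p & forall x, i (p x) = f x].
Proof.
have im x : f x \in image_pred by apply/asboolP; exists x.
have p_lin : linear (fun x => ImageModule (im x)).
  by move=> a x y; apply: val_inj; rewrite /= linearP.
exists image_module, (\val : {linear image_module -> N}), (make_linear p_lin).
split=> // [x y|[y y_im]]; first exact: val_inj.
by have /asboolP[x fx] := y_im; exists x; apply: val_inj.
Qed.

End Image.

Section Coherence.
Variable A : pzRingType.
Implicit Types M N : lmodType A.

(** Induction on the number of coordinates of the target. The first coordinate has a finitely
    generated left ideal as image; by coherence this ideal is finitely presented, so the kernel of
    that coordinate is finitely generated. The other coordinates are then treated on that kernel. *)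
Lemma coherent_kernel_fg m n (f : {linear 'rV[A]_m -> 'rV[A]_n}) :
  left_coherent A -> exists k (q : {linear 'rV[A]_k -> 'rV[A]_m}), exact_at q f.
Proof.
move=> A_coh; elim: n m f => [|n IHn] m f.
  exists m, (make_linear (f := id) (fun _ _ _ => erefl)) => y.
  by split=> _; [exists y | apply/rowP => -[]].
have f1_lin : linear (fun x => f x 0 0 : A^o) by move=> a x y; rewrite linearP !mxE.
have [I [i [p [i_inj p_surj ipE]]]] := image_factorization (make_linear f1_lin).
have I_fp : finitely_presented I.
  exact/(A_coh _ i i_inj)/(fg_surj p_surj)/fg_row.
have [k [r r_ker]] := fp_kernel_fg (fg_row A m) I_fp p_surj.
have r_ker1 y : f y 0 0 = 0 <-> exists z, r z = y.
  rewrite -r_ker; split=> [fy|py]; first by apply: i_inj; rewrite ipE linear0.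
  by have := ipE y; rewrite py linear0.
(* [col' 0] drops the coordinate already treated, and composing with [r] restricts the others to its
   kernel. *)
have [l [q q_ker]] := IHn k (make_linear (linearP (@col' A 1 n.+1 0)) \o f \o r).
exists l, (r \o q) => y; split=> [fy|[z <-]].
  have [x rx] : exists z, r z = y by apply/r_ker1; rewrite fy mxE.
  have [|z qz] := (q_ker x).1.
    by rewrite /= rx fy; apply/rowP => j; rewrite !mxE.
  by exists z; rewrite /= qz.
apply/rowP => j; rewrite mxE /=; case: (unliftP 0 j) => [j' ->|->].
  have /rowP/(_ j') : col' 0 (f (r (q z))) = 0 by apply/(q_ker (q z)); exists z.
  by rewrite !mxE.
by apply/r_ker1; exists (q z).
Qed.

(** The relations among the generators of [M] form the kernel of [i \o p], a map between free
    modules of finite rank. *)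
Lemma coherent_fp_submodule M n (i : {linear M -> 'rV[A]_n}) :
  left_coherent A -> injective i -> finitely_generated M -> finitely_presented M.
Proof.
move=> A_coh i_inj [m [p p_surj]].
have [k [q q_ker]] := coherent_kernel_fg (i \o p) A_coh.
exists k, m, q, p; split=> // y; rewrite -q_ker /=.
by split=> [->|ipy]; [rewrite linear0 | apply: i_inj; rewrite ipy linear0].
Qed.

End Coherence.

(** * Restriction and induction *)

(** An alias of the carrier, so that the scalings by [R] and by [S] on the same elements stay
    apart. *)
Definition restricted (R S : pzRingType) (f : {rmorphism R -> S})
  (N : lmodType S) : Type := N.

Section Restriction.
Variables (R S : pzRingType) (f : {rmorphism R -> S}).
Local Notation res := (restricted f).

HB.instance Definition _ N := GRing.Zmodule.copy (res N) N.

Definition restricted_scale N (r : R) (x : res N) : res N := f r *: (x : N).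

Fact restricted_scaleA N a b (x : res N) :
  restricted_scale a (restricted_scale b x) = restricted_scale (a * b) x.
Proof. by rewrite /restricted_scale scalerA rmorphM. Qed.

Fact restricted_scale1 N : left_id 1 (@restricted_scale N).
Proof. by move=> x; rewrite /restricted_scale rmorph1 scale1r. Qed.

Fact restricted_scaleDr N : right_distributive (@restricted_scale N) +%R.
Proof. by move=> a x y; rewrite /restricted_scale scalerDr. Qed.

Fact restricted_scaleDl N (x : res N) :
  {morph (@restricted_scale N)^~ x : a b / a + b}.
Proof. by move=> a b; rewrite /restricted_scale rmorphD scalerDl. Qed.

HB.instance Definition _ N := GRing.Zmodule_isLmodule.Build R (res N)
  (@restricted_scaleA N) (@restricted_scale1 N) (@restricted_scaleDr N)
  (@restricted_scaleDl N).

Lemma restrictedZE N (r : R) (x : res N) : r *: x = f r *: (x : N) :> N.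
Proof. by []. Qed.

Definition restrict_map (M N : lmodType S) (h : {linear M -> N}) :
  {linear res M -> res N}.
Proof.
by apply: (@make_linear _ _ _ (h : res M -> res N)) => a x y; exact: linearP.
Defined.

End Restriction.

(* Stands for both RG over R and its converse over the converse of R. *)
Record skew_extension (G : finGroupType) (R S : pzRingType)
    (alpha : ring_action G R) := SkewExtension {
  scalar : {rmorphism R -> S};
  group_elt : G -> S;
  coef : S -> G -> R;
  group_elt1 : group_elt 1%g = 1;
  group_eltM : forall g h, group_elt (g * h)%g = group_elt g * group_elt h;
  group_elt_scalar : forall g r,
    group_elt g * scalar r = scalar (alpha g r) * group_elt g;
  coef_sum : forall s, s = \sum_g scalar (coef s g) * group_elt g;
  coef_free : forall (a : G -> R) g,
    coef (\sum_h scalar (a h) * group_elt h) g = a g }.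

Section SkewExtensionTheory.
Variables (G : finGroupType) (R S : pzRingType) (alpha : ring_action G R).
Variable E : skew_extension S alpha.

Local Notation sc := (scalar E).
Local Notation ge := (group_elt E).
Local Notation co := (coef E).

Lemma ractK g r : alpha g (alpha g^-1%g r) = r.
Proof. by rewrite -ractM mulgV ract1. Qed.

Lemma ractVK g r : alpha g^-1%g (alpha g r) = r.
Proof. by rewrite -ractM mulVg ract1. Qed.

Lemma coef_eq (s : S) (a : G -> R) :
  s = \sum_g sc (a g) * ge g -> co s =1 a.
Proof. by move=> -> g; rewrite coef_free. Qed.

Lemma coefD s t g : co (s + t) g = co s g + co t g.
Proof.
move: g; apply: coef_eq; rewrite {1}[s](coef_sum E) {1}[t](coef_sum E) -big_split.
by apply: eq_bigr => g _; rewrite rmorphD mulrDl.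
Qed.

Lemma coef_mono r g x : co (sc r * ge g) x = if x == g then r else 0.
Proof.
move: x; apply: coef_eq; rewrite (bigD1 g) //= eqxx big1 ?addr0 // => h /negPf->.
by rewrite rmorph0 mul0r.
Qed.

Lemma coef1 g : co 1 g = if g == 1%g then 1 else 0.
Proof. by rewrite -coef_mono rmorph1 mul1r group_elt1. Qed.

Lemma coefM s t x : co (s * t) x = \sum_g co s g * alpha g (co t (g^-1 * x)%g).
Proof.
move: x; apply: coef_eq; rewrite {1}[s](coef_sum E) mulr_suml.
under [RHS]eq_bigr => x _ do rewrite rmorph_sum mulr_suml.
rewrite exchange_big; apply: eq_bigr => g _ /=.
rewrite {1}[t](coef_sum E) mulr_sumr [RHS](reindex_inj (mulgI g)).
apply: eq_bigr => h _.
by rewrite mulKg group_eltM rmorphM -!mulrA (mulrA (ge g)) group_elt_scalar !mulrA.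
Qed.

Lemma coef_scalarM r t g : co (sc r * t) g = r * co t g.
Proof.
move: g; apply: coef_eq; rewrite {1}[t](coef_sum E) mulr_sumr.
by apply: eq_bigr => g _; rewrite rmorphM mulrA.
Qed.

Lemma coef_group_eltM h t g : co (ge h * t) g = alpha h (co t (h^-1 * g)%g).
Proof.
rewrite coefM (bigD1 h) //= big1 ?addr0 => [|k /negPf kh].
  by rewrite -[ge h]mul1r -(rmorph1 sc) coef_mono eqxx mul1r.
by rewrite -[ge h]mul1r -(rmorph1 sc) coef_mono kh mul0r.
Qed.

(* u stands for the element \sum_g g (x) u g of the tensor product of S and M. *)
Definition induced (E : skew_extension S alpha) (M : lmodType R) : Type :=
  {ffun G -> M}.
Local Notation ind := (induced E).

HB.instance Definition _ M := GRing.Zmodule.copy (ind M) {ffun G -> M}.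

(** With k = gh, moving the scalar across the tensor sign gives r g (h (x) m) = k (x) k^-1(r) m;
    hence the twist by [alpha x^-1] in the coefficient at [x]. *)
Definition induced_scale M (s : S) (u : ind M) : ind M :=
  [ffun x => \sum_g alpha x^-1%g (co s g) *: u (g^-1 * x)%g].

Fact induced_scaleA M s t (u : ind M) :
  induced_scale s (induced_scale t u) = induced_scale (s * t) u.
Proof.
apply/ffunP => x; rewrite !ffunE.
under eq_bigr => g _ do rewrite ffunE scaler_sumr.
under [RHS]eq_bigr => g _ do rewrite coefM raddf_sum scaler_suml.
rewrite [RHS]exchange_big; apply: eq_bigr => g _ /=.
rewrite [RHS](reindex_inj (mulgI g)); apply: eq_bigr => h _ /=.
by rewrite scalerA mulKg rmorphM /= -ractM !invMg invgK mulgA.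
Qed.

Fact induced_scale1 M : left_id 1 (@induced_scale M).
Proof.
move=> u; apply/ffunP => x; rewrite !ffunE (bigD1 1%g) //= coef1 eqxx.
rewrite rmorph1 scale1r invg1 mul1g big1 ?addr0 // => g /negPf gN1.
by rewrite coef1 gN1 rmorph0 scale0r.
Qed.

Fact induced_scaleDr M : right_distributive (@induced_scale M) +%R.
Proof.
move=> s u v; apply/ffunP => x; rewrite !ffunE -big_split /=.
by apply: eq_bigr => g _; rewrite ffunE scalerDr.
Qed.

Fact induced_scaleDl M (u : ind M) : {morph (@induced_scale M)^~ u : s t / s + t}.
Proof.
move=> s t; apply/ffunP => x; rewrite !ffunE -big_split /=.
by apply: eq_bigr => g _; rewrite coefD rmorphD scalerDl.
Qed.

HB.instance Definition _ M := GRing.Zmodule_isLmodule.Build S (ind M)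
  (@induced_scaleA M) (@induced_scale1 M) (@induced_scaleDr M)
  (@induced_scaleDl M).

Lemma inducedZE M s (u : ind M) x :
  (s *: u) x = \sum_g alpha x^-1%g (co s g) *: u (g^-1 * x)%g.
Proof. by rewrite [LHS]ffunE. Qed.

Lemma induced_scalarZ M r (u : ind M) x : (sc r *: u) x = alpha x^-1%g r *: u x.
Proof.
rewrite inducedZE (bigD1 1%g) //= -[sc r]mulr1 -(group_elt1 E) coef_mono eqxx.
rewrite invg1 mul1g big1 ?addr0 // => g /negPf gN1.
by rewrite coef_mono gN1 rmorph0 scale0r.
Qed.

Lemma induced_group_eltZ M h (u : ind M) x : (ge h *: u) x = u (h^-1 * x)%g.
Proof.
rewrite inducedZE (bigD1 h) //= -[ge h]mul1r -(rmorph1 sc) coef_mono eqxx.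
rewrite rmorph1 scale1r big1 ?addr0 // => g /negPf gNh.
by rewrite coef_mono gNh rmorph0 scale0r.
Qed.

(** By [coef_sum] every element of [S] is a sum of products [sc r * ge g], so the two kinds of
    factors can be tested separately. *)
Lemma skew_linear (M N : lmodType S) (f : M -> N) :
  {morph f : x y / x + y} -> (forall r x, f (sc r *: x) = sc r *: f x) ->
  (forall g x, f (ge g *: x) = ge g *: f x) -> linear f.
Proof.
move=> fD f_sc f_ge s x y; rewrite fD; congr (_ + _).
rewrite {1}[s](coef_sum E) {2}[s](coef_sum E) !scaler_suml.
have f0 : f 0 = 0 by apply: (@addrI _ (f 0)); rewrite -fD !addr0.
rewrite (big_morph f fD f0); apply: eq_bigr => g _.
by rewrite -!scalerA f_sc f_ge.
Qed.

Local Notation res := (restricted sc).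

Definition induce_map (M N : lmodType R) (f : {linear M -> N}) :
  {linear ind M -> ind N}.
Proof.
apply: (@make_linear _ _ _ (fun u : ind M => [ffun g => f (u g)] : ind N)).
apply: skew_linear => [u v|r u|h u]; apply/ffunP => g.
- by rewrite !ffunE linearD.
- by rewrite [LHS]ffunE !induced_scalarZ linearZ ffunE.
- by rewrite [LHS]ffunE !induced_group_eltZ ffunE.
Defined.

(** The map m to 1 (x) m, unit of the adjunction in which induction is left adjoint to
    restriction. *)
Definition ind_unit (M : lmodType R) : {linear M -> res (ind M)}.
Proof.
apply: (@make_linear _ _ _
  (fun x => [ffun g => if g == 1%g then x else 0] : res (ind M))) => a x y.
apply/ffunP => g; rewrite [in RHS]ffunE restrictedZE induced_scalarZ !ffunE.
by case: eqP => [->|]; rewrite ?invg1 ?ract1 ?scaler0 ?addr0.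
Defined.

(** Counit of the adjunction in which induction is right adjoint to restriction. Together with
    [ind_unit] it makes [M] a retract of [res (ind M)]. *)
Definition ind_eval (M : lmodType R) : {linear res (ind M) -> M}.
Proof.
apply: (@make_linear _ _ _ (fun u : res (ind M) => (u : ind M) 1%g)) => a u v.
by rewrite ffunE restrictedZE induced_scalarZ invg1 ract1.
Defined.

Lemma ind_unitK M : cancel (ind_unit M) (ind_eval M).
Proof. by move=> x; rewrite /= ffunE eqxx. Qed.

Lemma ind_sum M (u : ind M) : u = \sum_g ge g *: (ind_unit M (u g) : ind M).
Proof.
apply/ffunP => x; rewrite sum_ffunE (bigD1 x) //= induced_group_eltZ ffunE.
rewrite mulVg eqxx big1 ?addr0 // => g gNx.
by rewrite induced_group_eltZ ffunE -eq_mulVg1 (negPf gNx).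
Qed.

(** Transpose of [f] under Hom_S(ind M, N) = Hom_R(M, res N). *)
Definition ind_left_adj (M : lmodType R) (N : lmodType S)
    (f : {linear M -> res N}) : {linear ind M -> N}.
Proof.
apply: (@make_linear _ _ _ (fun u : ind M => \sum_g ge g *: (f (u g) : N))).
apply: skew_linear => [u v|r u|h u].
- rewrite -big_split; apply: eq_bigr => g _ /=.
  by rewrite ffunE linearD -scalerDr.
- rewrite scaler_sumr; apply: eq_bigr => g _.
  by rewrite induced_scalarZ linearZ_LR restrictedZE !scalerA group_elt_scalar ractK.
- rewrite scaler_sumr (reindex_inj (mulgI h)); apply: eq_bigr => g _.
  by rewrite induced_group_eltZ mulKg scalerA group_eltM.
Defined.

(** Transpose of [f] under Hom_S(N, ind M) = Hom_R(res N, M): the coefficient at 1 must be [f], and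
    linearity over [S] then forces the coefficient at [g]. *)
Definition ind_right_adj (N : lmodType S) (M : lmodType R)
    (f : {linear res N -> M}) : {linear N -> ind M}.
Proof.
apply: (@make_linear _ _ _
  (fun x : N => [ffun g => f (ge g^-1%g *: x : N)] : ind M)).
apply: skew_linear => [x y|r x|h x]; apply/ffunP => g.
- by rewrite !ffunE scalerDr linearD.
- by rewrite induced_scalarZ !ffunE scalerA group_elt_scalar -scalerA -linearZ.
- by rewrite induced_group_eltZ !ffunE scalerA -group_eltM invMg invgK.
Defined.

End SkewExtensionTheory.

(** * Transfer of projectivity, finiteness, coherence and Ext *)

Section ChangeOfRings.
Variables (G : finGroupType) (R S : pzRingType) (alpha : ring_action G R).
Variable E : skew_extension S alpha.

Local Notation sc := (scalar E).
Local Notation ge := (group_elt E).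
Local Notation co := (coef E).
Local Notation ind := (induced E).
Local Notation res := (restricted (scalar E)).

Lemma induce_map_surj (M N : lmodType R) (f : {linear M -> N}) :
  surjective_map f -> surjective_map (induce_map E f).
Proof.
move=> /choice[v vE] u; exists [ffun g => v (u g)].
by apply/ffunP => g; rewrite !ffunE.
Qed.

Lemma induce_map_exact (M N F : lmodType R) (q : {linear M -> N})
    (p : {linear N -> F}) :
  exact_at q p -> exact_at (induce_map E q) (induce_map E p).
Proof.
move=> qp u; split=> [pu|[v <-]].
  have /choice[v vE] g : exists z, q z = u g.
    by apply/qp; have /ffunP/(_ g) := pu; rewrite !ffunE.
  by exists [ffun g => v g]; apply/ffunP => g; rewrite !ffunE.
apply/ffunP => g; rewrite !ffunE; by apply/qp; exists (v g).
Qed.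

(** A lifting problem for [ind P] transposes to one for [P], since restriction keeps surjections
    surjective. *)
Lemma induced_projective (P : lmodType R) : projective P -> projective (ind P).
Proof.
move=> P_proj B C p f p_surj.
have [h hE] := P_proj (res B) (res C) (restrict_map sc p)
  (restrict_map sc f \o ind_unit E P) p_surj.
exists (ind_left_adj h) => u; rewrite [in RHS](ind_sum u) !linear_sum.
by apply: eq_bigr => g _; rewrite !linearZ_LR hE.
Qed.

(** The other adjunction turns a lifting problem for [res P] into one for [P] along an induced
    surjection. *)
Lemma restricted_projective (P : lmodType S) : projective P -> projective (res P).
Proof.
move=> P_proj B C p f p_surj.
have [h hE] := P_proj (ind B) (ind C) (induce_map E p) (ind_right_adj f)
  (induce_map_surj p_surj).
exists (ind_eval E B \o restrict_map sc h) => x /=.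
have /ffunP/(_ 1%g) := hE x; rewrite !ffunE => ->.
by rewrite invg1 group_elt1 scale1r.
Qed.

Lemma restricted_row_fp n : finitely_presented (res 'rV[S]_n).
Proof.
pose b (t : 'I_n * G) : res 'rV[S]_n := ge t.2 *: delta_mx 0 t.1.
have bE (a : 'I_n * G -> R) :
    \sum_t a t *: b t = \row_i \sum_g sc (a (i, g)) * ge g :> 'rV[S]_n.
  transitivity (\sum_i \sum_g a (i, g) *: b (i, g)).
    by rewrite pair_bigA; apply: eq_bigr => -[].
  rewrite [RHS]row_sum_delta; apply: eq_bigr => i _.
  rewrite mxE scaler_suml; apply: eq_bigr => g _.
  by rewrite restrictedZE scalerA.
apply: (fp_basis (b := b) (c := fun x t => co ((x : 'rV[S]_n) 0 t.1) t.2)).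
  by move=> x; rewrite bE; apply/rowP => i; rewrite mxE [LHS](coef_sum E).
move=> a; rewrite bE => /rowP a0 [i g].
have := a0 i; rewrite !mxE => ai0.
rewrite -(coef_free E (fun g => a (i, g))) ai0.
(* Zero is written as [sc 0 * ge 1] so that [coef_mono] computes its coefficients. *)
by rewrite -(mul0r (ge 1%g)) -(rmorph0 sc) coef_mono; case: eqP.
Qed.

Lemma induced_row_fp n : finitely_presented (ind 'rV[R]_n).
Proof.
pose b (i : 'I_n) : ind 'rV[R]_n := ind_unit E _ (delta_mx 0 i).
have bE (a : 'I_n -> S) :
    \sum_i a i *: b i = [ffun g => \row_i alpha g^-1%g (co (a i) g)].
  apply/ffunP => g; rewrite sum_ffunE ffunE [RHS]row_sum_delta.
  apply: eq_bigr => i _; rewrite inducedZE mxE (bigD1 g) //= ffunE mulVg eqxx.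
  rewrite big1 ?addr0 // => h hNg.
  by rewrite ffunE -eq_mulVg1 (negPf hNg) scaler0.
(* Since g (x) r e_i = g r (1 (x) e_i) = g(r) g (1 (x) e_i), the coordinates carry the twist
   [alpha g]. *)
apply: (fp_basis (b := b) (c := fun u i => \sum_g sc (alpha g (u g 0 i)) * ge g)).
  move=> u; rewrite bE; apply/ffunP => g; rewrite ffunE; apply/rowP => i.
  by rewrite mxE coef_free ractVK.
move=> a; rewrite bE => /ffunP a0 i; rewrite [a i](coef_sum E) big1 // => g _.
have /rowP/(_ i) := a0 g; rewrite !ffunE !mxE => /(congr1 (alpha g)).
by rewrite ractK rmorph0 => ->; rewrite rmorph0 mul0r.
Qed.

Lemma restricted_fg (M : lmodType S) :
  finitely_generated M -> finitely_generated (res M).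
Proof.
move=> [n [p p_surj]].
exact: (fg_surj (p := restrict_map sc p)) p_surj (fp_fg (restricted_row_fp n)).
Qed.

Lemma restricted_fp (M : lmodType S) :
  finitely_presented M -> finitely_presented (res M).
Proof.
move=> [m [n [q [p [p_surj p_ker]]]]].
exact: (fp_quotient (r := restrict_map sc q) (p := restrict_map sc p)
  (fp_fg (restricted_row_fp m)) (restricted_row_fp n) p_surj p_ker).
Qed.

Lemma induced_fp (M : lmodType R) :
  finitely_presented M -> finitely_presented (ind M).
Proof.
move=> [m [n [q [p [p_surj p_ker]]]]].
exact: (fp_quotient (fp_fg (induced_row_fp m)) (induced_row_fp n)
  (induce_map_surj p_surj) (induce_map_exact p_ker)).
Qed.

Lemma induced_fg (M : lmodType R) :
  finitely_generated M -> finitely_generated (ind M).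
Proof.
move=> [n [p p_surj]].
exact: fg_surj (induce_map_surj p_surj) (fp_fg (induced_row_fp n)).
Qed.

(** As [res M] is finitely presented, the kernel of a cover of [M] by a free [S]-module is finitely
    generated over [R]; the same generators serve over [S]. *)
Lemma restricted_fp_inv (M : lmodType S) :
  finitely_generated M -> finitely_presented (res M) -> finitely_presented M.
Proof.
move=> [n [p p_surj]] M_fp.
have [m [r r_ker]] := fp_kernel_fg (p := restrict_map sc p)
  (fp_fg (restricted_row_fp n)) M_fp p_surj.
pose v i : 'rV[S]_n := r (delta_mx 0 i).
exists m, n, (row_map v), p; split=> // y; split=> [/r_ker[z <-]|[z <-]].
  exists (map_mx sc z); rewrite row_map_delta.
  by apply: eq_bigr => i _; rewrite mxE.
rewrite linear_row_map /= /row_comb big1 // => i _.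
have -> : p (v i) = 0 by apply/(r_ker (v i)); exists (delta_mx 0 i).
by rewrite scaler0.
Qed.

Fact scalar_linear : linear (sc : R^o -> res S^o).
Proof. by move=> a x y; rewrite rmorphD [sc _]rmorphM. Qed.

Definition ind_regular : {linear ind R^o -> S^o} :=
  ind_left_adj (make_linear scalar_linear).

Fact coef1_linear : linear (fun s : res S^o => co s 1%g : R^o).
Proof. by move=> a s t; rewrite coefD coef_scalarM. Qed.

(** Transpose of the coefficient at 1, which plays the role of a Frobenius form of [S] over [R]. *)
Definition regular_ind : {linear S^o -> ind R^o} :=
  ind_right_adj (E := E) (make_linear coef1_linear).

Lemma ind_regularK : cancel ind_regular regular_ind.
Proof.
move=> u; apply/ffunP => g; rewrite ffunE /= coef_group_eltM invgK mulg1.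
have -> : \sum_h ge h *: (sc (u h) : S^o)
    = \sum_h sc (alpha h (u h)) * ge h :> S.
  by apply: eq_bigr => h _; rewrite -group_elt_scalar.
by rewrite coef_free ractVK.
Qed.

Lemma regular_indK : cancel regular_ind ind_regular.
Proof.
move=> s; rewrite [RHS](coef_sum E); apply: eq_bigr => g _ /=.
rewrite ffunE coef_group_eltM invgK mulg1.
by rewrite [LHS]group_elt_scalar ractK.
Qed.

Lemma left_coherent_skewE : left_coherent S <-> left_coherent R.
Proof.
split=> [S_coh I i i_inj I_fg|R_coh I i i_inj I_fg].
  (* [ind I] embeds as a left ideal of [S], identified with [ind R^o]. Once it is finitely
     presented, so is its restriction, of which [I] is a retract. *)
  have ind_i_inj : injective (ind_regular \o induce_map E i).
    apply: inj_comp (can_inj ind_regularK) _ => u v uv.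
    apply/ffunP => g; apply: i_inj.
    by have /ffunP/(_ g) := uv; rewrite !ffunE.
  have ind_fp := S_coh _ _ ind_i_inj (induced_fg I_fg).
  exact: fp_retract (@ind_unitK _ _ _ _ E I) (restricted_fp ind_fp).
(* Over [R], the coefficients embed the ideal into a free module of rank [#|G|], where coherence of
   [R] applies. *)
apply: restricted_fp_inv => //.
have lin : linear (fun x : res I => \row_j co (i x) (enum_val j) : 'rV[R]_#|G|).
  by move=> a x y; apply/rowP => j; rewrite linearP !mxE coefD coef_scalarM.
apply: (coherent_fp_submodule (i := make_linear lin)) => //; last first.
  exact: restricted_fg.
move=> x y /rowP xy; apply: i_inj.
rewrite [LHS](coef_sum E) [RHS](coef_sum E); apply: eq_bigr => g _.
by have := xy (enum_rank g); rewrite !mxE enum_rankK => ->.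
Qed.

Definition induced_resolution (F : lmodType R) (P : proj_resolution F) :
  proj_resolution (ind F) :=
  ProjResolution (fun n => induced_projective (@res_proj _ _ P n))
    (induce_map_surj (@res_aug_surj _ _ P)) (induce_map_exact (@res_exact0 _ _ P))
    (fun n => induce_map_exact (@res_exactS _ _ P n)).

Definition restricted_resolution (F : lmodType S) (P : proj_resolution F) :
  proj_resolution (res F) :=
  @ProjResolution R (res F) (fun n => res (P n))
    (fun n => restrict_map sc (res_diff P n)) (restrict_map sc (res_aug P))
    (fun n => restricted_projective (@res_proj _ _ P n))
    (@res_aug_surj _ _ P) (@res_exact0 _ _ P) (@res_exactS _ _ P).

Lemma fp_Ext_vanishes_induced k (M : lmodType R) :
  fp_Ext_vanishes k (ind M) <-> fp_Ext_vanishes k M.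
Proof.
split=> [ind_ext F F_fp P f f_coc|M_ext F F_fp P f f_coc].
  (* The induced cocycle is a coboundary; cutting its primitive [h] down by [ind_unit] and
     [ind_eval] gives a primitive of [f]. *)
  have [|h hE] := ind_ext _ (induced_fp F_fp) (induced_resolution P)
    (induce_map E f).
    by move=> u; apply/ffunP => g; rewrite !ffunE f_coc.
  exists (ind_eval E M \o restrict_map sc h \o ind_unit E (P k)) => x.
  have /ffunP/(_ 1%g) := hE (ind_unit E _ x); rewrite !ffunE eqxx => ->.
  congr ((h _ : ind M) 1%g); apply/ffunP => g; rewrite !ffunE.
  by case: eqP => // _; rewrite linear0.
(* Here [f] is transposed to a cocycle on the restricted resolution, and the primitive found there
   is transposed back. *)
have [|h hE] := M_ext _ (restricted_fp F_fp) (restricted_resolution P)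
  (ind_eval E M \o restrict_map sc f).
  by move=> x; rewrite /= f_coc ffunE.
exists (ind_right_adj h) => x; apply/ffunP => g; rewrite ffunE.
(* The coefficient of [f x] at [g] is the coefficient at 1 of its translate by [g^-1]. *)
have := hE (ge g^-1%g *: (x : P k.+1)).
by rewrite /= !linearZ_LR induced_group_eltZ invgK mulg1.
Qed.

End ChangeOfRings.

(** Serves to carry vanishing both ways along the isomorphism of [S^o] with [ind R^o]. *)
Lemma fp_Ext_vanishes_retract (A : pzRingType) k (M N : lmodType A)
    (i : {linear M -> N}) (p : {linear N -> M}) :
  cancel i p -> fp_Ext_vanishes k N -> fp_Ext_vanishes k M.
Proof.
move=> iK N_ext F F_fp P f f_coc.
have [|h hE] := N_ext F F_fp P (i \o f); first by move=> x /=; rewrite f_coc linear0.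
by exists (p \o h) => x; rewrite /= -hE /= iK.
Qed.

Lemma inj10_dim_skewE (G : finGroupType) (R S : pzRingType)
    (alpha : ring_action G R) (E : skew_extension S alpha) n :
  @inj10_dim S S^o n <-> @inj10_dim R R^o n.
Proof.
have ext k : @fp_Ext_vanishes S k S^o <-> @fp_Ext_vanishes R k R^o.
  rewrite -(fp_Ext_vanishes_induced E k).
  split; first exact: fp_Ext_vanishes_retract (ind_regularK (E := E)).
  exact: fp_Ext_vanishes_retract (regular_indK E).
by split=> -[ext_n n_min]; split=> [|j /ext/n_min//]; apply/ext.
Qed.

(** * The skew group ring and its converse *)

Section Instances.
Variables (G : finGroupType) (R : pzRingType) (alpha : ring_action G R).
Local Notation RG := (skew_group_ring alpha).

Fact skew_scalar_zmod_morphism : zmod_morphism (fun r : R => skew_mono alpha r 1%g).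
Proof.
move=> r s; apply/ffunP => g; rewrite !ffunE.
by case: eqP => _ //; rewrite subr0.
Qed.

Fact skew_scalar_monoid_morphism :
  monoid_morphism (fun r : R => skew_mono alpha r 1%g).
Proof. by split=> // r s; rewrite skew_monoM ract1 mulg1. Qed.

Definition skew_scalar : {rmorphism R -> RG} :=
  HB.pack (fun r : R => skew_mono alpha r 1%g)
    (GRing.isZmodMorphism.Build _ _ _ skew_scalar_zmod_morphism)
    (GRing.isMonoidMorphism.Build _ _ _ skew_scalar_monoid_morphism).

Lemma skew_scalarM r g : skew_scalar r * skew_mono alpha 1 g = skew_mono alpha r g.
Proof. by rewrite skew_monoM mul1g rmorph1 mulr1. Qed.

Lemma skew_Mscalar r g :
  skew_mono alpha 1 g * skew_scalar r = skew_mono alpha (alpha g r) g.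
Proof. by rewrite skew_monoM mulg1 mul1r. Qed.

Lemma skew_scalar_sum (a : G -> R) g :
  (\sum_h skew_scalar (a h) * skew_mono alpha 1 h) g = a g.
Proof.
under eq_bigr do rewrite skew_scalarM.
have -> : \sum_h skew_mono alpha (a h) h = [ffun h => a h] :> RG.
  by rewrite [RHS]skew_mono_sum; apply: eq_bigr => h _; rewrite ffunE.
by rewrite ffunE.
Qed.

Definition skew_group_ring_extension : skew_extension RG alpha.
Proof.
apply: (@SkewExtension _ _ _ _ skew_scalar (skew_mono alpha 1) (fun u g => u g)).
- by [].
- by move=> g h; rewrite skew_monoM rmorph1 mulr1.
- by move=> g r; rewrite skew_Mscalar skew_scalarM.
- move=> u; rewrite {1}[u]skew_mono_sum.
  by apply: eq_bigr => g _; rewrite skew_scalarM.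
- exact: skew_scalar_sum.
Defined.


End Instances.

Section Converse.
Variables (G : finGroupType) (R : pzRingType) (alpha : ring_action G R).
Local Notation RG := (skew_group_ring alpha).

Definition converse_rmorphism (A B : pzRingType) (f : {rmorphism A -> B}) :
  {rmorphism A^c -> B^c} :=
  HB.pack (f : A^c -> B^c)
    (GRing.isZmodMorphism.Build A^c B^c f (raddfB f))
    (GRing.isMonoidMorphism.Build A^c B^c f
      (conj (rmorph1 f) (fun x y => rmorphM f y x))).

Definition converse_action : ring_action G R^c :=
  @RingAction G R^c (fun g => converse_rmorphism (alpha g))
    (ract1 alpha) (ractM alpha).

(* As g r = alpha g r g, reversing the product requires indexing the basis by
   inverses, and the coefficients get twisted accordingly. *)
Definition converse_skew_extension : skew_extension RG^c converse_action.
Proof.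
(* Products of the converse ring are read backwards in [RG]. Moving scalars to the left and
   reindexing by inverses yields the standard expansion there, from which coefficients can be
   read. *)
have basis (a : G -> R) :
    \sum_g (skew_mono alpha 1 g^-1 * skew_scalar alpha (a g) : RG)
    = \sum_g skew_scalar alpha (alpha g (a g^-1%g)) * skew_mono alpha 1 g.
  rewrite (reindex_inj invg_inj); apply: eq_bigr => g _.
  by rewrite invgK skew_Mscalar skew_scalarM.
apply: (@SkewExtension G R^c RG^c converse_action
  (converse_rmorphism (skew_scalar alpha)) (fun g => skew_mono alpha 1 g^-1)
  (fun u g => alpha g (u g^-1%g))).
- by rewrite invg1.
- by move=> g h; rewrite [RHS]skew_monoM rmorph1 mulr1 invMg.
- move=> g r; rewrite [LHS]skew_scalarM [RHS]skew_Mscalar.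
  by rewrite /= ractVK.
- move=> u; rewrite [RHS](basis (fun g => alpha g (u g^-1%g))) {1}[u]skew_mono_sum.
  by apply: eq_bigr => g _; rewrite skew_scalarM invgK ractK.
- move=> a g; have -> := basis a; by rewrite skew_scalar_sum invgK ractK.
Defined.

End Converse.

Theorem corollary4p9 (R : pzRingType) (G : finGroupType)
    (alpha : ring_action G R) :
  Ding_Chen_ring (skew_group_ring alpha) <-> Ding_Chen_ring R.
Proof.
have E := skew_group_ring_extension alpha.
have Ec := converse_skew_extension alpha.
(* Dimensions agree exactly, so the same [n] serves both ways; [E] settles the left conditions and
   [Ec] the right ones. *)
split=> -[n [coh cohc dimc dim]]; exists n; split.
- exact/(left_coherent_skewE E).
- exact/(left_coherent_skewE Ec).
- exact/(inj10_dim_skewE Ec).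
- exact/(inj10_dim_skewE E).
- exact/(left_coherent_skewE E).
- exact/(left_coherent_skewE Ec).
- exact/(inj10_dim_skewE Ec).
- exact/(inj10_dim_skewE E).
Qed.
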